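(* Let $n\geq 3$. The set of matrices $D_{n}^{1}(\mathbb{R})$ has a structure of commutative Lie group with respect to the multiplication of matrices. The dimension as a manifold of the Lie group $D_{n}^{1}(\mathbb{R})$ is $n-1$, and the corresponding Lie algebra is $$L(D_{n}^{1}(\mathbb{R}))=\{A=\mathrm{diag}(a_{1},\dots,a_{n})\ |\ a_1,\dots,a_n\in\mathbb{R},\ \mathrm{Trace}(A)=0\}.$$
   Context: $D_{n}^{1}(\mathbb{R})$ denotes $\mathcal{W}_{e}$, where $e\in S_n$ is the identity permutation and, for $\sigma\in S_n$, $\mathcal{W}_{\sigma}$ is the set of all $n\times n$ real matrices $\mathcal{P}_{\sigma}(a_{1},\dots,a_{n})$ having all entries zero except the entries in positions $(i,\sigma(i))$, which equal $a_i$ for $i=1,\dots,n$, with $\prod_{i=1}^{n}a_{i}=1$. Thus $D_{n}^{1}(\mathbb{R})=\{\mathrm{diag}(a_{1},\dots,a_{n})\ |\ a_i\in\mathbb{R},\ a_{1}a_2\cdots a_{n}=1\}$. The Lie algebra is identified with the tangent space at the identity matrix $I_n$, viewed as a subspace of $M_n(\mathbb{R})$ (velocities $\dot\alpha(0)$ of curves $\alpha$ in $D_n^1(\mathbb{R})$ with $\alpha(0)=I_n$). *)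

(* Defs.v *)
From HB Require Import structures.
From mathcomp Require Import all_boot all_order all_fingroup all_algebra.
From mathcomp Require Import all_classical all_reals all_analysis.

Set Implicit Arguments.
Unset Strict Implicit.
Unset Printing Implicit Defensive.

Import Order.TTheory GRing.Theory Num.Theory.
Import numFieldNormedType.Exports.

Local Open Scope classical_set_scope.
Local Open Scope ring_scope.

Section Smooth.
Context {R : realType} {V W : normedModType R}.

(* Only meant for [U] open and [V] finite-dimensional: there, this is
   equivalent to the existence and continuity on [U] of all iterated partial
   derivatives of order at most [k]. *)
Fixpoint Ck (k : nat) (U : set V) (f : V -> W) : Prop :=
  if k is k'.+1 then
    (forall x, U x -> differentiable f x) /\ (forall v : V, Ck k' U ('D_v f))
  else forall x, U x -> {for x, continuous f}.

Definition smooth_on (U : set V) (f : V -> W) : Prop := forall k, Ck k U f.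

End Smooth.

Section Manifold.
Context {R : realType}.

(* [chart_inv] is the inverse of [chart_map] on [chart_img]; [chart_map] and
   [chart_inv] are irrelevant outside [chart_dom] and [chart_img]. *)
Record chart (E : normedModType R) (T : topologicalType) := Chart {
  chart_dom : set T ;
  chart_map : T -> E ;
  chart_inv : E -> T }.

Definition chart_img (E : normedModType R) (T : topologicalType)
  (c : chart E T) : set E := chart_map c @` chart_dom c.

Definition is_chart (E : normedModType R) (T : topologicalType)
  (c : chart E T) : Prop :=
  [/\ open (chart_dom c), open (chart_img c),
      {in chart_dom c, cancel (chart_map c) (chart_inv c)},
      (forall x, chart_dom c x -> {for x, continuous (chart_map c)}) &
      (forall y, chart_img c y -> {for y, continuous (chart_inv c)})].

Definition smooth_compatible (E : normedModType R) (T : topologicalType)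
  (c1 c2 : chart E T) : Prop :=
  smooth_on (chart_map c1 @` (chart_dom c1 `&` chart_dom c2))
    (chart_map c2 \o chart_inv c1).

Definition smooth_atlas (E : normedModType R) (T : topologicalType)
  (A : set (chart E T)) : Prop :=
  [/\ (forall c, A c -> is_chart c),
      (forall x : T, exists2 c, A c & chart_dom c x) &
      (forall c1 c2, A c1 -> A c2 -> smooth_compatible c1 c2)].

Definition smooth_manifold (E : normedModType R) (T : topologicalType)
  (A : set (chart E T)) : Prop :=
  [/\ hausdorff_space T, @second_countable T & smooth_atlas A].

Definition id_atlas (E : normedModType R) : set (chart E E) :=
  [set Chart setT id id].

Definition prod_chart (E1 E2 : normedModType R) (T1 T2 : topologicalType)
  (c1 : chart E1 T1) (c2 : chart E2 T2) :
  chart (E1 * E2)%type (T1 * T2)%type :=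
  @Chart (E1 * E2)%type (T1 * T2)%type
    (chart_dom c1 `*` chart_dom c2)
    (fun p => (chart_map c1 p.1, chart_map c2 p.2))
    (fun q => (chart_inv c1 q.1, chart_inv c2 q.2)).

Definition prod_atlas (E1 E2 : normedModType R) (T1 T2 : topologicalType)
  (A1 : set (chart E1 T1)) (A2 : set (chart E2 T2)) :
  set (chart (E1 * E2)%type (T1 * T2)%type) :=
  [set c | exists c1 c2, [/\ A1 c1, A2 c2 & c = prod_chart c1 c2]].

Definition smooth_map (E1 E2 : normedModType R) (T1 T2 : topologicalType)
  (A1 : set (chart E1 T1)) (A2 : set (chart E2 T2)) (f : T1 -> T2) : Prop :=
  continuous f /\
  forall c1 c2, A1 c1 -> A2 c2 ->
    smooth_on (chart_map c1 @` (chart_dom c1 `&` f @^-1` chart_dom c2))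
      (chart_map c2 \o f \o chart_inv c1).

End Manifold.

Arguments id_atlas {R} E.

(* The smooth structure is the one generated by [lie_atlas]. *)
Record lie_group (R : realType) (d : nat) (T : topologicalType) := LieGroup {
  lie_mul : T -> T -> T ;
  lie_one : T ;
  lie_inv : T -> T ;
  lie_atlas : set (chart 'rV[R]_d T) ;
  lie_mulA : associative lie_mul ;
  lie_mul1g : left_id lie_one lie_mul ;
  lie_mulVg : left_inverse lie_one lie_inv lie_mul ;
  lie_manifold : smooth_manifold lie_atlas ;
  lie_mul_smooth : smooth_map (prod_atlas lie_atlas lie_atlas) lie_atlas
                     (fun p : T * T => lie_mul p.1 p.2) ;
  lie_inv_smooth : smooth_map lie_atlas lie_atlas lie_inv }.

(* The tangent space at the identity, seen in [V] through [iota : T -> V]: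
   the velocities at time 0 of the smooth curves passing through the identity
   at time 0. *)
Definition lie_algebra (R : realType) (d : nat) (T : topologicalType)
  (G : lie_group R d T) (V : normedModType R) (iota : T -> V) : set V :=
  [set X | exists alpha : R -> T,
     [/\ smooth_map (id_atlas R) (lie_atlas G) alpha,
         alpha 0 = lie_one G &
         is_derive (0 : R) 1 (iota \o alpha) X]].

Section WeightedPerm.
Context {R : realType} {n : nat}.

Definition wperm_mx (s : 'S_n) (a : 'I_n -> R) : 'M[R]_n :=
  \matrix_(i, j) (if j == s i then a i else 0).

Definition wperm_set (s : 'S_n) : set 'M[R]_n :=
  [set wperm_mx s a | a in [set a : 'I_n -> R | \prod_i a i = 1]].

End WeightedPerm.

(* Coerced to a type, this carries the subspace topology of ['M[R]_n]. *)
Definition diag1 (R : realType) (n : nat) : set 'M[R]_n := wperm_set 1%g.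

Arguments diag1 : clear implicits.

(* Main.v *)
Require Import Defs.
From HB Require Import structures.
From mathcomp Require Import all_boot all_order all_fingroup all_algebra.
From mathcomp Require Import all_classical all_reals all_analysis.
Import numFieldNormedType.Exports.
Local Open Scope classical_set_scope.
Local Open Scope ring_scope.

(** A determinant-one diagonal matrix diag(a_0, ..., a_m) is determined by
    a_1, ..., a_m, which can be any nonzero reals, since a_0 must be the inverse
    of their product.  So the group is covered by a single chart [gchart] onto
    the open set of vectors of R^m without zero coordinate: the dimension is m,
    one less than the size of the matrices, and the atlas has no transition map
    other than the identity.  In this chart the multiplication and the inversion
    are b_j c_j and 1 / b_j in each coordinate, hence smooth.  All smoothness
    claims reduce to a short calculus of [Ck] functions (sums, products,
    inverses, exponentials, matrices of functions), whose basic rules are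
    proved by induction on k from the corresponding rules of differentiation.

    For the Lie algebra, let alpha be a curve in the group through the identity.
    Its off-diagonal entries vanish identically, and so do their derivatives.
    The product of its diagonal entries is constantly 1; where all the factors
    are 1, the derivative of a product is the sum of the derivatives
    ([is_derive_prod1]), so the trace of the velocity is 0.  Conversely, if
    a_0 + ... + a_m = 0, then t |-> diag(exp(t a_0), ..., exp(t a_m)) is a
    smooth curve in the group, with velocity diag(a_0, ..., a_m) at time 0. *)

Set Implicit Arguments.
Unset Strict Implicit.
Unset Printing Implicit Defensive.

Import Order.TTheory GRing.Theory Num.Theory.

(** * Calculus of functions of class C^k *)

Section Calculus.
Context {R : realType} {V : normedModType R}.

(** Near [a] both functions have the same first-order expansion, and a
    continuous linear map giving such an expansion is the differential. *)
Lemma near_eq_differentiable {W : normedModType R} (f g : V -> W) (a : V) :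
  (\near a, f a = g a) -> differentiable f a -> differentiable g a.
Proof.
move=> fg df; have dfc := @diff_continuous _ _ _ _ _ df.
have exp_g : g \o shift a = cst (g a) + 'd f a +o_ 0 id.
  apply/eqaddoP => e e0.
  have /eqaddoP/(_ _ e0) := diff_locally df.
  have : \forall x \near (0 : V), f (x + a) = g (x + a).
    by move: (fg); rewrite (near_shift 0) subr0.
  apply: filterS2 => x fgx; rewrite !fctE /= fgx (nbhs_singleton fg).
  exact.
by apply/diff_locallyP; rewrite (diff_unique dfc exp_g).
Qed.

(** Chart expressions agree with explicit formulas only on the image of the
    chart; openness of [U] lets the derivatives follow the values. *)
Lemma Ck_eq {W : normedModType R} (k : nat) (U : set V) (f g : V -> W) :
  open U -> (forall x, U x -> f x = g x) -> Ck k U f -> Ck k U g.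
Proof.
move=> oU; elim: k f g => [|k IH] f g fg /=.
  move=> cf x Ux; rewrite /prop_for /continuous_at -(fg x Ux).
  apply: cvg_trans (cf x Ux).
  apply: near_eq_cvg; apply: filterS (open_nbhs_nbhs (conj oU Ux)) => y Uy.
  exact: fg.
have nfg x : U x -> \near x, f x = g x.
  move=> Ux; apply: filterS (open_nbhs_nbhs (conj oU Ux)) => y Uy.
  exact: fg.
move=> [df cDf]; split=> [x Ux|v].
  exact: near_eq_differentiable (nfg x Ux) (df x Ux).
by apply: IH (cDf v) => x Ux; exact: near_eq_derive (nfg x Ux).
Qed.

Lemma CkS {W : normedModType R} (k : nat) (U : set V) (f : V -> W) :
  Ck k.+1 U f -> Ck k U f.
Proof.
elim: k f => [|k IH] f [df cDf].
  by move=> x /df/differentiable_continuous.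
by split=> // v; apply/IH/cDf.
Qed.

Lemma Ck_cst {W : normedModType R} (k : nat) (U : set V) (w : W) :
  Ck k U (fun=> w).
Proof.
elim: k w => [|k IH] w /=; first by move=> x _; exact: cvg_cst.
split=> [x _|v]; first exact: differentiable_cst.
rewrite [X in Ck _ _ X](_ : _ = fun=> 0) //.
by apply/funext => x; exact: derive_cst.
Qed.

Lemma Ck_linear {W : normedModType R} (k : nat) (U : set V) (f : V -> W) :
  linear f -> continuous f -> Ck k U f.
Proof.
move=> lf cf; pose fM := GRing.isLinear.Build _ _ _ _ _ lf.
pose g : {linear V -> W} := HB.pack f fM.
have dg x : differentiable g x by exact: linear_differentiable.
case: k => [|k] /=; first by move=> x _; exact: cf.
split=> [x _|v]; first exact: dg.
rewrite [X in Ck _ _ X](_ : _ = fun=> f v); first exact: Ck_cst.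
by apply/funext => x; rewrite -[f]/(g : V -> W) deriveE // diff_lin.
Qed.

Section Open.
Context (U : set V) (oU : open U).

Lemma CkD {W : normedModType R} (k : nat) (f g : V -> W) :
  Ck k U f -> Ck k U g -> Ck k U (f \+ g).
Proof.
elim: k f g => [|k IH] f g /=.
  by move=> cf cg x Ux; apply: cvgD; [exact: cf|exact: cg].
move=> [df cDf] [dg cDg]; split=> [x Ux|v].
  exact: differentiableD (df x Ux) (dg x Ux).
apply: Ck_eq oU _ (IH _ _ (cDf v) (cDg v)) => x Ux /=.
rewrite -[f \+ g]/(f + g) deriveD//; apply: diff_derivable.
  exact: df.
exact: dg.
Qed.

Lemma Ck_sum {W : normedModType R} (k : nat) (I : Type) (r : seq I)
  (f : I -> V -> W) :
  (forall i, Ck k U (f i)) -> Ck k U (fun x => \sum_(i <- r) f i x).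
Proof.
move=> cf; elim: r => [|i r IH].
  by under eq_fun do rewrite big_nil; exact: Ck_cst.
by under eq_fun do rewrite big_cons; exact: CkD.
Qed.

(** If [f] and [g] are of class C^(k+1), then all four factors in Leibniz' rule
    for 'D_v (f * g) are of class C^k, two of them by [CkS]. *)
Lemma CkM (k : nat) (f g : V -> R) :
  Ck k U f -> Ck k U g -> Ck k U (f \* g).
Proof.
elim: k f g => [|k IH] f g /=.
  by move=> cf cg x Ux; apply: cvgM; [exact: cf|exact: cg].
move=> [df cDf] [dg cDg]; split=> [x Ux|v].
  exact: differentiableM (df x Ux) (dg x Ux).
have cf : Ck k U f by apply: CkS.
have cg : Ck k U g by apply: CkS.
apply: Ck_eq oU _ (CkD (IH _ _ cf (cDg v)) (IH _ _ cg (cDf v))) => x Ux /=.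
rewrite -[f \* g]/(f * g) deriveM//; apply: diff_derivable.
  exact: df.
exact: dg.
Qed.

Lemma Ck_prod (k : nat) (I : Type) (r : seq I) (f : I -> V -> R) :
  (forall i, Ck k U (f i)) -> Ck k U (fun x => \prod_(i <- r) f i x).
Proof.
move=> cf; elim: r => [|i r IH].
  by under eq_fun do rewrite big_nil; exact: Ck_cst.
by under eq_fun do rewrite big_cons; exact: CkM.
Qed.

Lemma CkZl {W : normedModType R} (k : nat) (f : V -> R) (w : W) :
  Ck k U f -> Ck k U (fun x => f x *: w).
Proof.
elim: k f => [|k IH] f /=.
  by move=> cf x Ux; apply: cvgZr_tmp; exact: cf.
move=> [df cDf]; split=> [x Ux|v]; first exact: differentiableZl (df x Ux).
apply: Ck_eq oU _ (IH _ (cDf v)) => x Ux /=.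
have dfx := df x Ux.
by rewrite (deriveE _ (differentiableZl w dfx)) (deriveE _ dfx) diffZl.
Qed.

(** The derivative of 1/f is - (1/f) (1/f) f', in which 1/f is C^k by
    induction. *)
Lemma CkV (k : nat) (f : V -> R) : (forall x, U x -> f x != 0) ->
  Ck k U f -> Ck k U (fun x => (f x)^-1).
Proof.
move=> f0; elim: k => [|k IH] /=.
  by move=> cf x Ux; apply: cvgV; [exact: f0|exact: cf].
move=> [df cDf]; split=> [x Ux|v].
  exact: differentiableV (df x Ux) (f0 x Ux).
have cV : Ck k U (fun x => (f x)^-1) by apply/IH/CkS.
have := CkM (CkM (CkM (Ck_cst k U (-1 : R)) cV) cV) (cDf v).
apply: Ck_eq oU _ => x Ux /=.
rewrite deriveV ?f0//; last exact/diff_derivable/df.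
by rewrite -[RHS]/(_ * _) expr2 invfM mulN1r !mulNr.
Qed.

Lemma Ck_expR (k : nat) (f : V -> R) : Ck k U f -> Ck k U (expR \o f).
Proof.
elim: k => [|k IH] /=.
  move=> cf x Ux; apply: continuous_comp; [exact: cf|exact: continuous_expR].
have dexp y : differentiable (@expR R) y by apply/derivable1_diffP.
move=> [df cDf]; split=> [x Ux|v]; first exact: differentiable_comp (df x Ux) _.
apply: Ck_eq oU _ (CkM (IH (CkS (conj df cDf))) (cDf v)) => x Ux /=.
have dfx := df x Ux.
rewrite (deriveE _ (differentiable_comp dfx (dexp _))) (deriveE _ dfx).
rewrite (diff_comp dfx (dexp _)) /= (diff1E (dexp _)) derive1E derive_val.
exact: mulrC.
Qed.

(** A matrix-valued function is the sum of its entries, each times a constant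
    elementary matrix. *)
Lemma Ck_mx (p q k : nat) (f : V -> 'M[R]_(p, q)) :
  (forall i j, Ck k U (fun x => f x i j)) -> Ck k U f.
Proof.
move=> cf.
rewrite (_ : f = fun x => \sum_i \sum_j f x i j *: delta_mx i j).
  by apply: Ck_sum => i; apply: Ck_sum => j; apply: CkZl.
by apply/funext => x; exact: matrix_sum_delta.
Qed.

End Open.
End Calculus.

(** In Leibniz' rule for several factors, the term of the i-th derivative is
    multiplied by the values of the other factors, which are all 1 at [x]. *)
Lemma is_derive_prod1 (R : realType) (V : normedModType R) (I : Type)
  (r : seq I) (f : I -> V -> R) (df : I -> R) (x v : V) :
  (forall i, f i x = 1) -> (forall i, is_derive x v (f i) (df i)) ->
  is_derive x v (fun t => \prod_(i <- r) f i t) (\sum_(i <- r) df i).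
Proof.
move=> f1 dfi; elim: r => [|i r IH].
  under eq_fun do rewrite big_nil.
  by rewrite big_nil; exact: is_derive_cst.
under eq_fun do rewrite big_cons.
rewrite big_cons; apply: is_derive_eq (is_deriveM (dfi i) IH) _.
by rewrite f1 [X in X *: df i]big1 ?scale1r 1?addrC.
Qed.

(** * Topology of spaces of matrices and of their subsets *)

Lemma mx_continuous_at {X : topologicalType} {T : topologicalType} (p q : nat)
  (f : X -> 'M[T]_(p, q)) (x : X) :
  (forall i j, {for x, continuous (fun y => f y i j)}) ->
  {for x, continuous f}.
Proof.
move=> cf A [P fxP sPA].
have : \forall y \near x, forall i j, P i j (f y i j).
  by apply: filter_forall => i; apply: filter_forall => j; apply/cf/fxP.
by apply: filterS => y Py; apply: sPA.
Qed.

Lemma set_val_continuous_at {X Y : topologicalType} (A : set Y) (f : X -> A)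
  (x : X) : {for x, continuous (set_val \o f)} -> {for x, continuous f}.
Proof.
move=> cf B [C [[D oD <-] Dfx sDB]].
by apply: filterS sDB _; apply: cf; exact: open_nbhs_nbhs.
Qed.

Lemma set_type_hausdorff {Y : topologicalType} (A : set Y) :
  hausdorff_space Y -> hausdorff_space A.
Proof.
move=> hY x y xy; apply: val_inj; apply: hY => B C xB yC.
have [z [Bz Cz]] := xy _ _ (@initial_continuous _ _ set_val _ _ xB)
                           (@initial_continuous _ _ set_val _ _ yC).
by exists (set_val z).
Qed.

Lemma set_type_second_countable {Y : topologicalType} (A : set Y) :
  @second_countable Y -> @second_countable A.
Proof.
move=> [B cB [oB bB]]; exists [set set_val @^-1` C | C in B].
  by apply: sub_countable cB; exact: card_image_le.
split=> [_ [C BC <-]|x U [V [[D oD <-] Dx sDU]]].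
  by exists C => //; exact: oB.
have [C [BC Cx] sCD] := bB (set_val x) D (open_nbhs_nbhs (conj oD Dx)).
exists (set_val @^-1` C); first by split=> //; exists C.
by move=> y Cy; apply: sDU; exact: sCD.
Qed.

(** The balls with a rational matrix as centre and a radius 1/(k+1) form a
    basis: if 2/(k+1) <= e and the centre is within 1/(k+1) of a point, then
    the ball lies inside the ball of radius e around this point. *)
Lemma mx_second_countable (R : realType) (p q : nat) :
  @second_countable 'M[R]_(p, q).
Proof.
pose B (u : 'M[rat]_(p, q) * nat) : set 'M[R]_(p, q) :=
  ball (map_mx ratr u.1 : 'M[R]_(p, q)) u.2.+1%:R^-1.
exists (range B).
  apply: sub_countable (countableP [set: 'M[rat]_(p, q) * nat]).
  exact: card_image_le.
split=> [_ [u _ <-]|M U]; first by apply: ball_open; rewrite invr_gt0.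
move=> /nbhs_ballP[e /= e0 sU].
have [k ke] : exists k, k.+1%:R^-1 + k.+1%:R^-1 <= e :> R.
  pose e2 := PosNum (divr_gt0 e0 (ltr0n _ 2)).
  have [k _ /(_ k (leqnn k))] := near_infty_natSinv_lt e2.
  by exists k; rewrite [leRHS]splitr lerD // ltW.
have k0 : 0 < k.+1%:R^-1 :> R by rewrite invr_gt0.
have [Q MQ] : exists Q : 'M[rat]_(p, q), forall i j,
    ball (M i j) k.+1%:R^-1 (ratr (Q i j) : R).
  have rat_near (i : 'I_p) (j : 'I_q) : exists r : rat,
      ball (M i j) k.+1%:R^-1 (ratr r : R).
    have oB : open (ball (M i j) (k.+1%:R^-1 : R)) by exact: ball_open.
    have nB : ball (M i j) (k.+1%:R^-1 : R) !=set0.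
      by exists (M i j); exact: ballxx.
    by have [x [Bx [r _ rx]]] := dense_rat nB oB; exists r; rewrite rx.
  exists (\matrix_(i, j) sval (cid (rat_near i j))) => i j; rewrite mxE.
  exact: svalP (cid (rat_near i j)).
have BM : ball (map_mx ratr Q : 'M[R]_(p, q)) k.+1%:R^-1 M.
  by apply: ball_sym; split=> // i j; rewrite mxE; exact: MQ.
exists (B (Q, k)); first by split=> //; exists (Q, k).
move=> N BN; apply: sU; apply: le_ball ke _ _.
by apply: ball_triangle BN; exact: ball_sym.
Qed.

Lemma fst_continuous {X Y : topologicalType} : continuous (@fst X Y).
Proof. by move=> p; exact: (@cvg_fst _ _ (nbhs p.1) (nbhs p.2) _). Qed.

Lemma snd_continuous {X Y : topologicalType} : continuous (@snd X Y).
Proof. by move=> p; exact: (@cvg_snd _ _ (nbhs p.1) (nbhs p.2) _). Qed.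

(** * The group of diagonal matrices of determinant one *)

Section Diag.
Context {R : realType} {m : nat}.
Local Notation D := (diag1 R m.+1).

Lemma wperm1_mxE (a : 'I_m.+1 -> R) i j :
  wperm_mx 1%g a i j = if j == i then a i else 0.
Proof. by rewrite mxE perm1. Qed.

Definition dcoord (x : D) (i : 'I_m.+1) : R := set_val x i i.

Lemma dcoord_mxE (x : D) : set_val x = wperm_mx 1%g (dcoord x).
Proof.
have [a _ ax] := set_valP x; apply/matrixP => i j.
by rewrite /dcoord set_valE -ax !wperm1_mxE eqxx.
Qed.

Lemma prod_dcoord (x : D) : \prod_i dcoord x i = 1.
Proof.
have [a a1 ax] := set_valP x; rewrite -[RHS]a1; apply: eq_bigr => i _.
by rewrite /dcoord set_valE -ax wperm1_mxE eqxx.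
Qed.

Lemma dcoord_neq0 (x : D) i : dcoord x i != 0.
Proof.
apply: contra_eq_neq (prod_dcoord x) => xi0.
by rewrite (bigD1 i)//= xi0 mul0r eq_sym oner_neq0.
Qed.

Lemma dcoord_inj (x y : D) : dcoord x =1 dcoord y -> x = y.
Proof.
move=> /funext xy; apply: val_inj; rewrite -!set_valE.
by rewrite !dcoord_mxE xy.
Qed.

Lemma one_in_diag1 : (wperm_mx 1%g (fun=> 1) : 'M[R]_m.+1) \in D.
Proof. by apply/mem_set; exists (fun=> 1) => //=; rewrite big1. Qed.

Definition diag_one : D := exist (fun M => M \in D) _ one_in_diag1.

(** Matrices whose diagonal does not have product 1 are sent to the identity;
    this is what makes the inverse of the chart a total function. *)
Definition diag_of (a : 'I_m.+1 -> R) : D := insubd diag_one (wperm_mx 1%g a).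

Lemma diag_ofK (a : 'I_m.+1 -> R) :
  \prod_i a i = 1 -> dcoord (diag_of a) =1 a.
Proof.
move=> a1 i; rewrite /dcoord set_valE val_insubd ifT.
  by rewrite wperm1_mxE eqxx.
by apply/mem_set; exists a.
Qed.

Lemma dcoord1 i : dcoord diag_one i = 1.
Proof. by rewrite /dcoord set_valE /= wperm1_mxE eqxx. Qed.

Definition diag_mul (x y : D) : D := diag_of (fun i => dcoord x i * dcoord y i).
Definition diag_inv (x : D) : D := diag_of (fun i => (dcoord x i)^-1).

Lemma dcoordM x y i : dcoord (diag_mul x y) i = dcoord x i * dcoord y i.
Proof. by rewrite diag_ofK // big_split /= !prod_dcoord mulr1. Qed.

Lemma dcoordV x i : dcoord (diag_inv x) i = (dcoord x i)^-1.
Proof. by rewrite diag_ofK // prodfV prod_dcoord invr1. Qed.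

Lemma diag_mulA : associative diag_mul.
Proof. by move=> x y z; apply: dcoord_inj => i; rewrite !dcoordM mulrA. Qed.

Lemma diag_mulC : commutative diag_mul.
Proof. by move=> x y; apply: dcoord_inj => i; rewrite !dcoordM mulrC. Qed.

Lemma diag_mul1g : left_id diag_one diag_mul.
Proof. by move=> x; apply: dcoord_inj => i; rewrite dcoordM dcoord1 mul1r. Qed.

Lemma diag_mulVg : left_inverse diag_one diag_inv diag_mul.
Proof.
move=> x; apply: dcoord_inj => i.
by rewrite dcoordM dcoordV dcoord1 mulVf // dcoord_neq0.
Qed.

Lemma set_val_diag_mul x y : set_val (diag_mul x y) = set_val x *m set_val y.
Proof.
rewrite !dcoord_mxE; apply/matrixP => i j; rewrite wperm1_mxE dcoordM mxE.
rewrite (bigD1 i)//= !wperm1_mxE eqxx big1 ?addr0 => [|k ki].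
  by case: eqP; rewrite ?mulr0.
by rewrite wperm1_mxE (negPf ki) mul0r.
Qed.

(** * The global chart *)

Lemma dcoord_continuous i : continuous (dcoord^~ i).
Proof.
move=> x; apply: (@continuous_comp _ _ _ set_val (fun M : 'M[R]_m.+1 => M i i)).
  exact: initial_continuous.
exact: coord_continuous.
Qed.

(** The group has the topology induced from the space of matrices, and
    off-diagonal entries are constant. *)
Lemma diag_continuous_at {X : topologicalType} (f : X -> D)
  (g : X -> 'I_m.+1 -> R) (x : X) :
  (\forall y \near x, dcoord (f y) =1 g y) ->
  (forall i, {for x, continuous (g^~ i)}) -> {for x, continuous f}.
Proof.
move=> fg cg; apply/set_val_continuous_at/mx_continuous_at => i j.
pose h y := if j == i then g y i else 0.
have ch : {for x, continuous h}.
  by rewrite /h; case: eqP => _; [exact: cg | exact: cvg_cst].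
have hf : \forall y \near x, h y = (set_val \o f) y i j.
  by apply: filterS fg => y fy; rewrite /= dcoord_mxE wperm1_mxE fy.
rewrite /prop_for /continuous_at -(nbhs_singleton hf).
exact: cvg_trans (near_eq_cvg hf) ch.
Qed.

Lemma diag_continuous {X : topologicalType} (f : X -> D)
  (g : X -> 'I_m.+1 -> R) :
  (forall y, dcoord (f y) =1 g y) -> (forall i, continuous (g^~ i)) ->
  continuous f.
Proof.
move=> fg cg x; apply: diag_continuous_at (nearW _ fg) _ => i; exact: cg.
Qed.

Definition gchart_map (x : D) : 'rV[R]_m := \row_j dcoord x (lift ord0 j).

(** For [b] without zero coordinate, this is the diagonal of the only
    determinant-one diagonal matrix whose last [m] diagonal entries are [b]. *)
Definition gchart_coord (b : 'rV[R]_m) (i : 'I_m.+1) : R :=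
  if unlift ord0 i is Some j then b 0 j else (\prod_j b 0 j)^-1.

Definition gchart : chart 'rV[R]_m D :=
  Chart setT gchart_map (fun b => diag_of (gchart_coord b)).

Definition nonzero_coords : set 'rV[R]_m := [set b | forall j, b 0 j != 0].

Lemma nonzero_coords_open : open nonzero_coords.
Proof.
rewrite openE => b nzb.
have nz_near (j : 'I_m) : \forall c \near b, (c : 'rV[R]_m) 0 j != 0.
  exact: cvgr_neq0 _ (@coord_continuous R 1 m 0 j b) (nzb j).
exact: (filter_forall _ nz_near).
Qed.

Lemma nonzero_coords_prod_neq0 b : nonzero_coords b -> \prod_j b 0 j != 0.
Proof.
by move=> nzb; rewrite prodf_seq_neq0; apply/allP => j _; exact: nzb.
Qed.

Lemma prod_gchart_coord b : nonzero_coords b -> \prod_i gchart_coord b i = 1.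
Proof.
move=> nzb; rewrite big_ord_recl /gchart_coord unlift_none.
rewrite [X in _ * X](_ : _ = \prod_j b 0 j); last first.
  by apply: eq_bigr => j _; rewrite liftK.
by rewrite mulVf // nonzero_coords_prod_neq0.
Qed.

Lemma dcoord_gchart_inv b i :
  nonzero_coords b -> dcoord (chart_inv gchart b) i = gchart_coord b i.
Proof. by move=> nzb; rewrite /= diag_ofK // prod_gchart_coord. Qed.

Lemma gchart_img : chart_map gchart @` setT = nonzero_coords.
Proof.
apply/seteqP; split=> [_ [x _ <-] j|b nzb]; first by rewrite mxE dcoord_neq0.
exists (chart_inv gchart b) => //; apply/rowP => j.
by rewrite mxE dcoord_gchart_inv // /gchart_coord liftK.
Qed.

Lemma gchartK : cancel gchart_map (chart_inv gchart).
Proof.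
move=> x.
have nzx : nonzero_coords (gchart_map x) by rewrite -gchart_img; exists x.
apply: dcoord_inj => i; rewrite dcoord_gchart_inv // /gchart_coord.
case: unliftP => [j|] ->; first by rewrite mxE.
have prod_neq0 := nonzero_coords_prod_neq0 nzx.
apply: (mulIf prod_neq0); rewrite (mulVf prod_neq0).
rewrite -[LHS](prod_dcoord x) big_ord_recl; congr (_ * _).
by apply: eq_bigr => j _; rewrite mxE.
Qed.

Lemma Ck_coord (k : nat) (U : set 'rV[R]_m) j :
  Ck k U (fun b : 'rV[R]_m => b 0 j).
Proof.
apply: Ck_linear; last exact: coord_continuous.
by move=> c a b; rewrite !mxE.
Qed.

Lemma Ck_gchart_coord k i : Ck k nonzero_coords (gchart_coord^~ i).
Proof.
rewrite /gchart_coord; case: unlift => [j|]; first exact: Ck_coord.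
apply: CkV; first exact: nonzero_coords_open.
  exact: nonzero_coords_prod_neq0.
by apply: Ck_prod; [exact: nonzero_coords_open | move=> j; exact: Ck_coord].
Qed.

Lemma gchart_is_chart : is_chart gchart.
Proof.
split.
- exact: openT.
- by rewrite /chart_img gchart_img; exact: nonzero_coords_open.
- by move=> x _; exact: gchartK.
- move=> x _; apply: mx_continuous_at => i j.
  rewrite [X in {for _, continuous X}](_ : _ = dcoord^~ (lift ord0 j)).
    exact: dcoord_continuous.
  by apply/funext => y; rewrite mxE.
- rewrite /chart_img gchart_img => b nzb.
  apply: (diag_continuous_at (g := gchart_coord)) => [|i].
    apply: filterS (open_nbhs_nbhs (conj nonzero_coords_open nzb)) => c nzc i.
    exact: dcoord_gchart_inv.
  exact: Ck_gchart_coord 0 i b nzb.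
Qed.

Definition gatlas : set (chart 'rV[R]_m D) := [set gchart].

Lemma gatlas_manifold : smooth_manifold gatlas.
Proof.
split.
- exact/set_type_hausdorff/norm_hausdorff.
- exact/set_type_second_countable/mx_second_countable.
split=> [_ ->|x|_ _ -> ->]; first exact: gchart_is_chart.
  by exists gchart.
rewrite /smooth_compatible setIT gchart_img => k.
have cid : Ck k nonzero_coords (id : 'rV[R]_m -> 'rV[R]_m).
  by apply: Ck_linear => // ?.
apply: Ck_eq nonzero_coords_open _ cid.
move=> b nzb; apply/rowP => j.
by rewrite mxE dcoord_gchart_inv // /gchart_coord liftK.
Qed.

End Diag.

(** * Smoothness of the group operations *)

Section Group.
Context {R : realType} {m : nat}.
Local Notation D := (diag1 R m.+1).

Lemma diag_mul_smooth :
  smooth_map (prod_atlas gatlas gatlas) gatlas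
    (fun p : D * D => diag_mul p.1 p.2).
Proof.
split=> [|_ _ [_ [_ [-> -> ->]]] ->].
  apply: diag_continuous => [p|i p]; first exact: dcoordM.
  apply: cvgM.
    by apply: (@continuous_comp _ _ _ fst (@dcoord R m ^~ i));
      [exact: fst_continuous | exact: dcoord_continuous].
  by apply: (@continuous_comp _ _ _ snd (@dcoord R m ^~ i));
    [exact: snd_continuous | exact: dcoord_continuous].
pose N : set ('rV[R]_m * 'rV[R]_m)%type := nonzero_coords `*` nonzero_coords.
rewrite [X in smooth_on X _](_ : _ = N).
  have oN : open N.
    rewrite openE => -[b c] [nzb nzc].
    exists (nonzero_coords, nonzero_coords) => //.
    by split; exact: (open_nbhs_nbhs (conj nonzero_coords_open _)).
  move=> k; apply: Ck_mx => // i j; rewrite ord1.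
  have cfst : Ck k N (fun q => q.1 0 j).
    apply: Ck_linear => [c p q|q]; first by rewrite !mxE.
    by apply: (@continuous_comp _ _ _ fst (fun b : 'rV[R]_m => b 0 j));
      [exact: fst_continuous | exact: coord_continuous].
  have csnd : Ck k N (fun q => q.2 0 j).
    apply: Ck_linear => [c p q|q]; first by rewrite !mxE.
    by apply: (@continuous_comp _ _ _ snd (fun b : 'rV[R]_m => b 0 j));
      [exact: snd_continuous | exact: coord_continuous].
  apply: Ck_eq oN _ (CkM oN cfst csnd) => -[b c] [/= nzb nzc].
  by rewrite mxE dcoordM !dcoord_gchart_inv // /gchart_coord liftK.
rewrite /N -!gchart_img; apply/seteqP.
split=> [_ [[x y] _ <-]|[b c] [[x _ xb] [y _ yc]]].
  by split; [exists x|exists y].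
by exists (x, y) => //=; congr pair.
Qed.

Lemma diag_inv_smooth : smooth_map gatlas gatlas (@diag_inv R m).
Proof.
split=> [|_ _ -> ->].
  apply: diag_continuous => [x|i x]; first exact: dcoordV.
  apply: (@cvgV _ _ _ (nbhs_filter x) _ _ (dcoord_neq0 x i)).
  exact: dcoord_continuous.
rewrite setTI preimage_setT gchart_img => k; apply: Ck_mx => [|i j].
  exact: nonzero_coords_open.
rewrite ord1.
have cV : Ck k nonzero_coords (fun b : 'rV[R]_m => (b 0 j)^-1).
  by apply: CkV; [exact: nonzero_coords_open|move=> b; exact|exact: Ck_coord].
apply: Ck_eq nonzero_coords_open _ cV => b nzb.
by rewrite mxE dcoordV dcoord_gchart_inv // /gchart_coord liftK.
Qed.

Definition diag_lie_group : lie_group R m D :=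
  LieGroup (@diag_mulA R m) (@diag_mul1g R m) (@diag_mulVg R m)
    gatlas_manifold diag_mul_smooth diag_inv_smooth.

(** * The Lie algebra *)

Lemma velocity_diag_traceless (A : 'M[R]_m.+1) :
  lie_algebra diag_lie_group (set_val : D -> 'M[R]_m.+1) A ->
  (exists a : 'rV[R]_m.+1, A = diag_mx a) /\ \tr A = 0.
Proof.
move=> [alpha [_ alpha0 dA]].
have dAij i j : is_derive (0 : R) 1 (fun t => set_val (alpha t) i j) (A i j).
  have [dv Av] := dA.
  apply: DeriveDef; first exact: (derivable_mxP _ _ _).1 dv i j.
  by rewrite -Av derive_mx // mxE.
have Aoff i j : i != j -> A i j = 0.
  move=> ij; have := dAij i j.
  rewrite [X in is_derive _ _ X _](_ : _ = fun=> 0).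
    by move=> [_ <-]; exact: derive_cst.
  by apply/funext => t; rewrite dcoord_mxE wperm1_mxE eq_sym (negPf ij).
split.
  exists (\row_i A i i); apply/matrixP => i j; rewrite !mxE.
  by case: eqP => [->|/eqP ij] //; exact: Aoff.
have dprod : is_derive (0 : R) 1 (fun t => \prod_i dcoord (alpha t) i) (\tr A).
  by apply: is_derive_prod1 => // i; rewrite alpha0; exact: dcoord1.
move: dprod; rewrite [X in is_derive _ _ X _](_ : _ = fun=> 1).
  by move=> [_ <-]; exact: derive_cst.
by apply/funext => t; exact: prod_dcoord.
Qed.

Lemma prod_expR_traceless (a : 'rV[R]_m.+1) (t : R) : \tr (diag_mx a) = 0 ->
  \prod_i expR (t * a 0 i) = 1.
Proof.
by rewrite mxtrace_diag -expR_sum => a0; rewrite -mulr_sumr a0 mulr0 expR0.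
Qed.

Lemma traceless_diag_velocity (a : 'rV[R]_m.+1) : \tr (diag_mx a) = 0 ->
  lie_algebra diag_lie_group (set_val : D -> 'M[R]_m.+1) (diag_mx a).
Proof.
move=> a0; pose alpha (t : R) : D := diag_of (fun i => expR (t * a 0 i)).
have alphaE t i : dcoord (alpha t) i = expR (t * a 0 i).
  by rewrite diag_ofK // prod_expR_traceless.
have smooth_e k i : Ck k setT (fun t : R => expR (t * a 0 i)).
  have cl : Ck k (setT : set R) (fun t : R => t * a 0 i).
    apply: CkM; [exact: openT| |exact: Ck_cst].
    by apply: (Ck_linear k setT (f := id)) => // ?.
  exact: (Ck_expR openT cl).
exists alpha; split.
- split=> [|_ _ -> ->].
    apply: diag_continuous => [t|i t]; first exact: alphaE.
    exact: (smooth_e 0 i t I).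
  rewrite /= setTI preimage_setT image_id => k.
  apply: Ck_mx => [|i j]; first exact: openT.
  apply: Ck_eq openT _ (smooth_e k (lift ord0 j)) => t _.
  by rewrite mxE alphaE.
- by apply: dcoord_inj => i; rewrite alphaE dcoord1 mul0r expR0.
have dij i j :
    is_derive (0 : R) 1 (fun t => set_val (alpha t) i j) (diag_mx a i j).
  rewrite [X in is_derive _ _ X _](_ : _ = fun t =>
      if j == i then expR (t * a 0 i) else 0); last first.
    by apply/funext => t; rewrite dcoord_mxE wperm1_mxE alphaE.
  rewrite mxE eq_sym; case: eqP => [_|_]; last exact: is_derive_cst.
  have dl : is_derive (0 : R) 1 (id * cst (a 0 i)) (a 0 i).
    apply: is_derive_eq (is_deriveM (is_derive_id _ _) (is_derive_cst _ _ _)) _.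
    by rewrite scaler0 add0r [LHS]mulr1.
  rewrite -[X in is_derive _ _ X _]/(expR \o (id * cst (a 0 i))).
  apply: is_derive_eq (is_derive1_comp (is_derive_expR _) dl) _.
  by rewrite [X in expR X](mul0r (a 0 i)) expR0 mul1r.
have dv : derivable (set_val \o alpha) (0 : R) 1.
  by apply/derivable_mxP => i j; have [] := dij i j.
apply: DeriveDef => //; rewrite derive_mx //; apply/matrixP => i j.
by rewrite mxE; have [_] := dij i j.
Qed.

End Group.

Unset Implicit Arguments.

Theorem proposition4 (R : realType) (n : nat) (hn : (3 <= n)%N) :
  exists G : lie_group R (n - 1) (diag1 R n),
    [/\ (forall x y : diag1 R n,
           set_val (lie_mul G x y) = set_val x *m set_val y),
        commutative (lie_mul G) &
        lie_algebra G (set_val : diag1 R n -> 'M[R]_n) =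
          [set A : 'M[R]_n | (exists a : 'rV[R]_n, A = diag_mx a) /\ \tr A = 0]].
Proof.
case: n hn => [//|m] _; rewrite subn1 /=.
exists diag_lie_group; split.
- exact: set_val_diag_mul.
- exact: diag_mulC.
- apply/seteqP; split=> [A|A [[a ->]]]; first exact: velocity_diag_traceless.
  exact: traceless_diag_velocity.
Qed.
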